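(* For all $n\ge2$, we have $c_n(123,213,312)=n+2$.
   Context: A word $\pi=\pi_1\dots\pi_m$ over the positive integers contains the pattern $\sigma=\sigma_1\dots\sigma_k$ if there are indices $1\le i_1<\dots<i_k\le m$ such that for all $r,s\in\{1,\dots,k\}$: $\pi_{i_r}<\pi_{i_s}$ iff $\sigma_r<\sigma_s$, and $\pi_{i_r}=\pi_{i_s}$ iff $\sigma_r=\sigma_s$; otherwise $\pi$ avoids $\sigma$. $\mathcal{C}_n$ denotes the set of nonnesting permutations: arrangements (words) of the multiset $\{1,1,2,2,\dots,n,n\}$ that avoid the patterns $1221$ and $2112$. For patterns $\sigma,\tau,\dots$, $c_n(\sigma,\tau,\dots)$ is the number of $\pi\in\mathcal{C}_n$ avoiding all of $\sigma,\tau,\dots$. *)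

(* Defs.v *)
From mathcomp Require Import all_boot.

Set Implicit Arguments.
Unset Strict Implicit.
Unset Printing Implicit Defensive.

(* The witness f lists the 0-based positions i_1 < ... < i_k of an occurrence. *)
Definition contains (w sigma : seq nat) : bool :=
  [exists f : {ffun 'I_(size sigma) -> 'I_(size w)},
    [forall r : 'I_(size sigma), forall s : 'I_(size sigma),
      [&& (r < s) ==> (f r < f s),
          (nth 0 w (f r) < nth 0 w (f s)) == (nth 0 sigma r < nth 0 sigma s)
        & (nth 0 w (f r) == nth 0 w (f s)) ==
            (nth 0 sigma r == nth 0 sigma s)]]].

Definition avoids (w sigma : seq nat) : bool := ~~ contains w sigma.

Definition double_multiset (n : nat) : seq nat := iota 1 n ++ iota 1 n.

Definition nonnesting (n : nat) (w : seq nat) : bool :=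
  [&& perm_eq w (double_multiset n),
      avoids w [:: 1; 2; 2; 1]
    & avoids w [:: 2; 1; 1; 2]].

(* [permutations s] is duplicate-free even when s has repeated entries, so each
   arrangement of the multiset is listed, hence counted, exactly once. *)
Definition nonnestings (n : nat) : seq (seq nat) :=
  [seq w <- permutations (double_multiset n) | nonnesting n w].

Definition c (n : nat) (patterns : seq (seq nat)) : nat :=
  count (fun w => all (avoids w) patterns) (nonnestings n).

(* Main.v *)
Require Import Defs.
From mathcomp Require Import all_boot.
From mathcomp Require Import zify.

Set Implicit Arguments.
Unset Strict Implicit.
Unset Printing Implicit Defensive.

(** The count is c_2 = 4 together with c_{n+1} = c_n + 1 for n >= 2.  The
    recurrence comes from looking at the two 1s of an avoider w on n+1 letters.

    If w starts with a letter a > 1, then a letter b other than 1 and a cannot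
    occur after a 1, since a 1 b would be a 213 or a 312.  Nor can a itself:
    as n + 1 >= 3, some third letter b would then have both copies between the
    first a and that 1, and a b b a would be a 1221 or a 2112.  So w is
    u 1 1 with u an avoider on {2, ..., n+1} ([avoider_headN1]), and conversely
    appending 1 1 to such a u creates no occurrence ([avoids_cat_nseq]).  This
    accounts for c_n words ([ones_last]).

    If w starts with 1, then the letters larger than 1 weakly decrease, since
    w has no 123, so they read n+1 n+1 n n ... 2 2; inserting the second 1
    anywhere but right after the first creates a 312 or a 1221
    ([avoider_head1]).  This accounts for one more word ([ones_first]).

    Occurrences are handled as subsequences order-isomorphic to the pattern
    ([containsP]); once the subsequence is explicit, a contradiction is a
    matter of linear arithmetic on its letters. *)

(** * Occurrences as subsequences *)

(** Equalities between letters are not compared: in a total order they are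
    determined by the strict comparisons in both directions. *)
Definition order_iso (s t : seq nat) : bool :=
  (size s == size t) &&
  all (fun i => all (fun j =>
    (nth 0 s i < nth 0 s j) == (nth 0 t i < nth 0 t j))
    (iota 0 (size t))) (iota 0 (size t)).

Lemma order_isoP s t :
  reflect (size s = size t /\ forall i j, i < size t -> j < size t ->
             (nth 0 s i < nth 0 s j) = (nth 0 t i < nth 0 t j))
          (order_iso s t).
Proof.
apply: (iffP andP) => [[/eqP eq_sz /allP iso]|[eq_sz iso]]; split=> //.
- move=> i j lt_i lt_j; have := iso i.
  rewrite mem_iota => /(_ lt_i)/allP/(_ j).
  by rewrite mem_iota => /(_ lt_j)/eqP.
- exact/eqP.
- apply/allP=> i; rewrite mem_iota => lt_i.
  by apply/allP=> j; rewrite mem_iota => lt_j; rewrite iso.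
Qed.

Lemma order_iso_map_succ s t : order_iso (map succn s) t = order_iso s t.
Proof.
apply/order_isoP/order_isoP; rewrite size_map => -[eq_sz iso];
  split=> // i j lt_i lt_j; have := iso i j lt_i lt_j;
  by rewrite !(nth_map 0) ?eq_sz.
Qed.

(** Translates between the index embeddings of [contains] and [subseq]. *)
Lemma subseq_nthP (s w : seq nat) :
  reflect (exists idx, [/\ sorted ltn idx, all (gtn (size w)) idx
                         & s = map (nth 0 w) idx])
          (subseq s w).
Proof.
have defw : map (nth 0 w) (iota 0 (size w)) = w by exact: mkseq_nth.
apply: (iffP idP) => [/subseqP[m sz_m ->]|[idx [srt bnd ->]]].
- exists (mask m (iota 0 (size w))); split.
  + exact: sorted_mask ltn_trans _ _ (iota_ltn_sorted _ _).
  + by apply/allP=> i /mem_mask; rewrite mem_iota.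
  + by rewrite map_mask defw.
- rewrite -{2}defw; apply: map_subseq.
  (* A strictly increasing list of indices below [size w] is a filter of
     [iota 0 (size w)], hence a subsequence of it. *)
  suff -> : idx = [seq i <- iota 0 (size w) | i \in idx].
    exact: filter_subseq.
  apply: (irr_sorted_eq ltn_trans ltnn) => //.
    exact: sorted_filter ltn_trans _ _ (iota_ltn_sorted _ _).
  move=> i; rewrite mem_filter mem_iota /=.
  by case: (boolP (i \in idx)) => // /(allP bnd) /= lt_i; rewrite lt_i.
Qed.

Lemma containsP w sigma :
  reflect (exists2 s, subseq s w & order_iso s sigma) (contains w sigma).
Proof.
apply: (iffP existsP) => [[f /forallP occ]|[s /subseq_nthP[idx [srt bnd ->]]]].
- have {}occ r s := forallP (occ r) s.
  exists [seq nth 0 w (f r) | r : 'I_(size sigma)].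
  + apply/subseq_nthP; exists [seq val (f r) | r : 'I_(size sigma)]; split.
    * rewrite /image_mem sorted_map.
      have : sorted (relpre val ltn) (enum 'I_(size sigma)).
        by rewrite -sorted_map val_enum_ord iota_ltn_sorted.
      apply: sub_sorted => r s /= lt_rs.
        by have /and3P[/implyP/(_ lt_rs)] := occ r s.
    * by apply/allP=> _ /mapP[r _ ->] /=.
    * by rewrite -map_comp.
  + apply/order_isoP; rewrite size_map -cardE card_ord.
    split=> // i j lt_i lt_j.
    have nthE k (lt_k : k < size sigma) :
        nth 0 [seq nth 0 w (f r) | r : 'I_(size sigma)] k
        = nth 0 w (f (Ordinal lt_k)).
      rewrite (nth_map (Ordinal lt_k)) -?cardE ?card_ord //.
      by rewrite (nth_ord_enum _ (Ordinal lt_k)).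
    rewrite (nthE _ lt_i) (nthE _ lt_j).
    by have /and3P[_ /eqP-> _] := occ (Ordinal lt_i) (Ordinal lt_j).
- move=> /order_isoP[]; rewrite size_map => eq_sz iso.
  have lt_idx (r : 'I_(size sigma)) : nth 0 idx r < size w.
    by apply: (allP bnd); rewrite mem_nth ?eq_sz.
  exists [ffun r => Ordinal (lt_idx r)].
  apply/forallP=> r; apply/forallP=> r'; rewrite !ffunE /=.
  have {iso} lt_iso (i j : 'I_(size sigma)) :
      (nth 0 w (nth 0 idx i) < nth 0 w (nth 0 idx j))
      = (nth 0 sigma i < nth 0 sigma j).
    by rewrite -iso // !(nth_map 0) ?eq_sz.
  apply/and3P; split; last by rewrite !eqn_leq !(leqNgt (nth 0 _ _)) !lt_iso.
  + apply/implyP=> lt_rs.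
    by apply: (sorted_ltn_nth ltn_trans) => //; rewrite inE eq_sz.
  + by rewrite lt_iso.
Qed.

Lemma avoids_subseq w sigma s :
  avoids w sigma -> subseq s w -> ~~ order_iso s sigma.
Proof. by move=> /containsP av sub; apply/negP=> iso; apply: av; exists s. Qed.

(** Together with [containsE], makes containment computable: the finite
    quantifiers in [contains] do not reduce. *)
Fixpoint subseqs (w : seq nat) : seq (seq nat) :=
  if w is x :: w' then map (cons x) (subseqs w') ++ subseqs w' else [:: [::]].

Lemma mem_subseqs s w : (s \in subseqs w) = subseq s w.
Proof.
elim: w s => [|x w IHw] [|y s] /=;
  rewrite ?mem_cat ?inE // !IHw ?sub0seq ?orbT //.
case: eqP => [->|ne]; last first.
  by case: mapP => // -[t _ [/ne]].
rewrite mem_map => [|? ? []//]; rewrite IHw.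
by apply/orb_idr; apply: subseq_trans; apply: subseq_cons.
Qed.

Lemma containsE w sigma :
  contains w sigma = has (order_iso^~ sigma) (subseqs w).
Proof.
apply/containsP/hasP=> -[s]; first by rewrite -mem_subseqs; exists s.
by rewrite mem_subseqs; exists s.
Qed.

Lemma avoids_map_succ w sigma : avoids (map succn w) sigma = avoids w sigma.
Proof.
congr (~~ _); rewrite !containsE.
have -> : subseqs (map succn w) = map (map succn) (subseqs w).
  elim: w => //= x w ->; rewrite map_cat -!map_comp.
  by congr (_ ++ _); apply: eq_map.
by rewrite has_map; apply: eq_has => s /=; apply: order_iso_map_succ.
Qed.

(** An occurrence that uses an appended minimum m has last letter m, so its
    i-th letter, being at most the last one, is m too; but then that letter
    lies in the appended block and nothing larger follows it, against the
    ascent from i to j. *)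
Lemma avoids_cat_nseq u m k sigma i j :
    all (ltn m) u -> i < j < size sigma -> nth 0 sigma i < nth 0 sigma j ->
    nth 0 sigma i <= last 0 sigma ->
  avoids (u ++ nseq k m) sigma = avoids u sigma.
Proof.
move=> u_gt /andP[lt_ij lt_j] asc le_last; congr (~~ _).
apply/containsP/containsP => -[s sub iso]; last first.
  by exists s => //; apply: subseq_trans sub (prefix_subseq _ _).
have [s1 [s2 [sub1 /allP s2m def_s]]] : exists s1 s2,
    [/\ subseq s1 u, all (pred1 m) s2 & s = s1 ++ s2].
  have /subseqP[msk sz_msk ->] := sub; move: sz_msk; rewrite size_cat => sz_msk.
  exists (mask (take (size u) msk) u), (mask (drop (size u) msk) (nseq k m)).
  rewrite mask_subseq -mask_cat ?size_takel ?sz_msk ?leq_addr //.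
  by rewrite cat_take_drop; split=> //; apply/allP=> x /mem_mask/nseqP[->] /=.
case: s2 s2m def_s => [|x s2] s2m def_s.
  by exists s; rewrite // def_s cats0.
have [sz_s lt_s] := order_isoP _ _ iso.
have sz_pos : 0 < size sigma by apply: leq_trans lt_j.
have last_m : nth 0 s (size sigma).-1 = m.
  rewrite -sz_s nth_last def_s last_cat /=.
  exact: (eqP (s2m _ (mem_last x s2))).
have nth_m r : size s1 <= r < size sigma -> nth 0 s r = m.
  rewrite -sz_s def_s size_cat nth_cat => /andP[ge_r lt_r].
  rewrite ltnNge ge_r /=; apply/eqP/s2m/mem_nth => /=; move: lt_r => /=; lia.
have le_i : size s1 <= i.
  rewrite leqNgt; apply/negP=> lt_i.
  have gt_m : m < nth 0 s i.
    rewrite def_s nth_cat lt_i; apply: (allP u_gt); apply: mem_subseq sub1 _ _.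
    exact: mem_nth.
  have lt_last : (size sigma).-1 < size sigma by rewrite prednK.
  have := lt_s _ _ lt_last (ltn_trans lt_ij lt_j).
  by rewrite last_m gt_m nth_last ltnNge le_last.
have := lt_s i j (ltn_trans lt_ij lt_j) lt_j.
by rewrite asc !nth_m ?ltnn //; lia.
Qed.

(** * The words to be counted *)

(** The two patterns of the nonnesting condition are treated on a par with the
    three others. *)
Definition patterns : seq (seq nat) :=
  [:: [:: 1; 2; 2; 1]; [:: 2; 1; 1; 2];
      [:: 1; 2; 3]; [:: 2; 1; 3]; [:: 3; 1; 2]].

Definition avoiders (n : nat) : seq (seq nat) :=
  [seq w <- permutations (double_multiset n) | all (avoids w) patterns].

Lemma mem_avoiders n w :
  (w \in avoiders n) =
  perm_eq w (double_multiset n) && all (avoids w) patterns.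
Proof. by rewrite mem_filter mem_permutations andbC. Qed.

Lemma c_avoiders n :
  c n [:: [:: 1; 2; 3]; [:: 2; 1; 3]; [:: 3; 1; 2]] = size (avoiders n).
Proof.
rewrite /c /nonnestings count_filter -size_filter; congr size.
apply: eq_in_filter => w; rewrite mem_permutations => pw /=.
by rewrite /nonnesting pw /=; do 5!case: (avoids w _).
Qed.

Lemma size_avoiders2 : size (avoiders 2) = 4.
Proof.
rewrite size_filter.
rewrite (eq_count (a2 := fun w => all (fun sigma =>
  ~~ has (order_iso^~ sigma) (subseqs w)) patterns)); first by vm_compute.
by move=> w; apply: eq_all => sigma; rewrite /avoids containsE.
Qed.


(** * Structure of the avoiders *)

Lemma subseq_pairwiseP (r : rel nat) s :
  (forall x y, subseq [:: x; y] s -> r x y) -> pairwise r s.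
Proof.
elim: s => //= x s IHs rs; apply/andP; split.
  by apply/allP=> y sy; apply: rs; rewrite eqxx sub1seq.
by apply: IHs => y z sub; apply: rs (subseq_trans sub (subseq_cons s x)).
Qed.

Lemma double_multisetS n :
  perm_eq (double_multiset n.+1) [:: 1, 1 & map succn (double_multiset n)].
Proof.
rewrite /double_multiset /= perm_cons map_cat -(iotaDl 1 1).
by rewrite -cat_cons perm_sym -cat_rcons perm_cat2r perm_sym perm_rcons.
Qed.

Lemma count_double_multiset n x :
  count_mem x (double_multiset n) = (0 < x <= n).*2.
Proof. by rewrite count_cat count_uniq_mem ?iota_uniq // mem_iota addnn. Qed.

Fixpoint decreasing_word (n : nat) : seq nat :=
  if n is m.+1 then [:: m.+1, m.+1 & decreasing_word m] else [::].

Lemma perm_decreasing_word n : perm_eq (decreasing_word n) (double_multiset n).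
Proof.
have iota_last m : iota 1 m.+1 = iota 1 m ++ [:: m.+1].
  by have := iotaD 1 m 1; rewrite addn1 add1n.
elim: n => // n /permP IHn; apply/permP=> P; have := IHn P.
by rewrite /double_multiset iota_last !count_cat /=; lia.
Qed.

Lemma pairwise_decreasing_word n : pairwise geq (map succn (decreasing_word n)).
Proof.
rewrite pairwise_map; elim: n => //= n ->; rewrite andbT leqnn andbb /=.
apply/allP=> x; rewrite (perm_mem (perm_decreasing_word n)).
by rewrite mem_cat mem_iota /=; lia.
Qed.

(** A pair of letters x .. y of 1 1 v satisfies x = 1 or 1 < y <= x, and none
    of the five patterns is compatible with this for all its pairs. *)
Lemma avoids_ones_decreasing v :
  pairwise geq v -> all (ltn 1) v -> all (avoids [:: 1, 1 & v]) patterns.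
Proof.
move=> v_dec v_gt.
have w_pair : pairwise (fun x y => (x == 1) || (1 < y <= x)) [:: 1, 1 & v].
  rewrite /= !all_predT !andTb.
  apply: (sub_in_pairwise (P := ltn 1)) v_dec => //.
  by move=> x y; rewrite !inE /= => _ gt_y le_yx; rewrite gt_y le_yx orbT.
apply/allP=> sigma in_pat; apply/negP=> /containsP[s sub].
have {w_pair sub} := subseq_pairwise sub w_pair.
by move: in_pat; rewrite !inE => /or4P[|||/orP[]] /eqP->;
  case: s => [|a [|b [|d [|e [|? ?]]]]] //=; rewrite /order_iso /=; lia.
Qed.

(** The indices passed to [avoids_cat_nseq] mark, in each pattern, an ascent
    whose lower letter is at most the last letter of the pattern. *)
Lemma avoids_succ_cat_ones w :
    all (ltn 0) w ->
  all (avoids (map succn w ++ [:: 1; 1])) patterns = all (avoids w) patterns.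
Proof.
move=> w_gt; apply: eq_in_all => sigma in_pat; rewrite -(avoids_map_succ w).
have u_gt : all (ltn 1) (map succn w) by rewrite all_map.
move: in_pat; rewrite !inE => /or4P[|||/orP[]] /eqP->.
- exact: (@avoids_cat_nseq _ 1 2 _ 0 1).
- exact: (@avoids_cat_nseq _ 1 2 _ 2 3).
- exact: (@avoids_cat_nseq _ 1 2 _ 0 1).
- exact: (@avoids_cat_nseq _ 1 2 _ 0 2).
- exact: (@avoids_cat_nseq _ 1 2 _ 1 2).
Qed.

(** Write the word as 1 p 1 q.  Absence of 123 makes p q weakly decreasing, so
    p q = N N M M ... with N = n+1 and M = n.  If p is the single letter N, then
    N 1 M is a 312; if p is longer, then 1 N N 1 is a 1221. *)
Lemma avoider_head1 n w :
    1 < n -> perm_eq (1 :: w) (double_multiset n.+1) ->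
    all (avoids (1 :: w)) patterns ->
  w = 1 :: map succn (decreasing_word n).
Proof.
move=> n_gt1 perm_w /allP av.
have {}perm_w : perm_eq w (1 :: map succn (double_multiset n)).
  by rewrite -(perm_cons 1); apply: perm_trans perm_w (double_multisetS n).
have w1 : 1 \in w by rewrite (perm_mem perm_w) inE.
move: perm_w av; case/path.splitPr: w1 => p q perm_w av.
have {}perm_pq : perm_eq (p ++ q) (map succn (double_multiset n)).
  rewrite -(perm_cons 1); apply: perm_trans perm_w.
  by rewrite perm_sym -[1 :: q]cat1s perm_catCA.
have gt_pq : all (ltn 1) (p ++ q).
  rewrite (perm_all _ perm_pq) all_map; apply/allP=> x /=.
  by rewrite mem_cat mem_iota /=; lia.
have def_pq : p ++ q = map succn (decreasing_word n).
  apply: (@sorted_eq _ geq) => [x y z|x y|||].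
  - by rewrite /geq /=; lia.
  - by rewrite /geq /=; lia.
  - rewrite sorted_pairwise; last by move=> x y z; rewrite /geq /=; lia.
    apply: subseq_pairwiseP => x y sub.
    have sub1 : subseq [:: 1; x; y] (1 :: p ++ 1 :: q).
      rewrite -[[:: 1; x; y]]cat1s -[1 :: p ++ _]cat1s.
      apply: cat_subseq => //; apply: subseq_trans sub _.
      by apply: cat_subseq => //; apply: subseq_cons.
    have gt_x : 1 < x.
      by apply: (allP gt_pq); apply: (mem_subseq sub); rewrite inE eqxx.
    have := avoids_subseq (av [:: 1; 2; 3] isT) sub1.
    by rewrite /order_iso /=; lia.
  - apply: pairwise_sorted; exact: pairwise_decreasing_word.
  - apply: perm_trans perm_pq _; apply: perm_map.
    by rewrite perm_sym perm_decreasing_word.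
case: p {perm_w perm_pq gt_pq} def_pq av => [|x p] def_pq av.
  by rewrite -def_pq.
case: n n_gt1 def_pq => [|[|n]] //= _ [-> {x} def_p] in av *.
case: p def_p av => [|y p] /= => [->|[-> _]] av.
- have sub : subseq [:: n.+3; 1; n.+2]
      [:: 1, n.+3, 1, n.+3, n.+2, n.+2 & map succn (decreasing_word n)].
    apply: subseq_trans (subseq_cons _ 1).
    apply: (@cat_subseq _ [:: n.+3; 1] [:: n.+2] [:: n.+3; 1]) => //.
    by rewrite sub1seq !inE eqxx orbT.
  have := avoids_subseq (av [:: 3; 1; 2] isT) sub.
  by rewrite /order_iso /=; lia.
- have sub : subseq [:: 1; n.+3; n.+3; 1] [:: 1, n.+3, n.+3 & p ++ 1 :: q].
    apply: (@cat_subseq _ [:: 1; n.+3; n.+3] [:: 1] [:: 1; n.+3; n.+3]) => //.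
    by rewrite sub1seq mem_cat inE eqxx orbT.
  have := avoids_subseq (av [:: 1; 2; 2; 1] isT) sub.
  by rewrite /order_iso /=; lia.
Qed.

Lemma subseq_nseq_count (T : eqType) (x : T) s :
  subseq (nseq (count_mem x s) x) s.
Proof.
have /all_pred1P := filter_all (pred1 x) s.
by rewrite size_filter => <-; apply: filter_subseq.
Qed.

(** Whatever occurrence of 1 is chosen, only 1s can follow it; applied to the
    first one, this puts both 1s at the end. *)
Lemma avoider_headN1 n a w :
    1 < n -> a != 1 -> perm_eq (a :: w) (double_multiset n.+1) ->
    all (avoids (a :: w)) patterns ->
  exists2 p, all (ltn 1) p & a :: w = p ++ [:: 1; 1].
Proof.
move=> n_gt1 a_neq1 perm_w /allP av.
have cnt x : count_mem x (a :: w) = (0 < x <= n.+1).*2.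
  by rewrite (permP perm_w) count_double_multiset.
have bnd x : x \in a :: w -> 0 < x <= n.+1.
  by rewrite -has_pred1 has_count cnt; case: (_ && _).
have a_gt1 : 1 < a by have := bnd a (mem_head _ _); lia.
have tail_ones p q : w = p ++ 1 :: q -> all (pred1 1) q.
  move=> def_w; rewrite def_w -cat_cons in av cnt bnd.
  have in_1a b : b \in q -> (b == 1) || (b == a).
    move=> qb; have b_gt0 : 0 < b.
      by have := bnd b; rewrite mem_cat !inE qb !orbT => /(_ isT)/andP[].
    have sub : subseq [:: a; 1; b] ((a :: p) ++ 1 :: q).
      apply: (@cat_subseq _ [:: a] [:: 1; b]).
        by rewrite sub1seq mem_head.
      by rewrite /= sub1seq.
    have := avoids_subseq (av [:: 2; 1; 3] isT) sub.
    have := avoids_subseq (av [:: 3; 1; 2] isT) sub.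
    by rewrite /order_iso /=; lia.
  have a_notin : a \notin q.
    apply/negP=> qa.
    (* A third letter b exists because there are at least three letters; it
       does not occur in q, so both its copies are in p. *)
    have [b b_neq_a b_bnd] : exists2 b, b != a & 1 < b <= n.+1.
      case: (eqVneq a 2) => [->|a_neq2]; first by exists 3.
      by exists 2; [rewrite eq_sym | lia].
    have /count_memPn b_notin : b \notin q.
      by apply/negP=> /in_1a; rewrite (negPf b_neq_a) orbF => /eqP; lia.
    have b_p : count_mem b p = 2.
      by have := cnt b; rewrite count_cat /= b_notin; lia.
    have sub : subseq [:: a; b; b; a] ((a :: p) ++ 1 :: q).
      apply: (@cat_subseq _ [:: a; b; b] [:: a]).
        by rewrite /= eqxx -[[:: b; b]]/(nseq 2 b) -b_p subseq_nseq_count.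
      by rewrite sub1seq inE qa orbT.
    have := avoids_subseq (av [:: 1; 2; 2; 1] isT) sub.
    have := avoids_subseq (av [:: 2; 1; 1; 2] isT) sub.
    by rewrite /order_iso /=; lia.
  apply/allP=> b qb; have /orP[//|/eqP b_a] := in_1a b qb.
  by rewrite -b_a qb in a_notin.
(* [split_find] cuts at the first 1. *)
have w1 : has (pred1 1) w.
  by have := cnt 1; rewrite has_count /= (negPf a_neq1) add0n => ->.
move: tail_ones cnt bnd; case/split_find: w1 => _ p q /eqP-> p1.
rewrite cat_rcons => /(_ p q erefl) q1 cnt bnd; exists (a :: p).
  apply/allP=> x px; have := bnd x; rewrite -cat_cons mem_cat px.
  have x_neq1 : x != 1.
    apply: contraNneq p1 => x1; move: px; rewrite x1 inE eq_sym.
    by rewrite (negPf a_neq1) has_pred1.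
  by move=> /(_ isT) /=; lia.
have q_sz : size q = 1.
  have := cnt 1; rewrite -cat_cons count_cat /= (negPf a_neq1).
  have /count_memPn -> : 1 \notin p by rewrite -has_pred1.
  by move: q1; rewrite all_count => /eqP-> [].
by move/all_pred1P: q1 => ->; rewrite q_sz.
Qed.

(** * The recurrence *)

Definition ones_first n := [:: 1, 1 & map succn (decreasing_word n)].
Definition ones_last w := map succn w ++ [:: 1; 1].

Lemma ones_first_avoider n : ones_first n \in avoiders n.+1.
Proof.
rewrite mem_avoiders avoids_ones_decreasing ?pairwise_decreasing_word //.
- rewrite andbT perm_sym; apply: perm_trans (double_multisetS n) _.
  by rewrite !perm_cons perm_map // perm_sym perm_decreasing_word.
- rewrite all_map (perm_all _ (perm_decreasing_word n)); apply/allP=> x /=.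
  by rewrite mem_cat mem_iota /=; lia.
Qed.

Lemma ones_last_avoider n w :
  (ones_last w \in avoiders n.+1) = (w \in avoiders n).
Proof.
have perm_w : perm_eq (ones_last w) (double_multiset n.+1)
            = perm_eq w (double_multiset n).
  rewrite (permPr (double_multisetS n)) /ones_last perm_catC !perm_cons.
  by apply/idP/idP => [/(perm_map_inj succn_inj)|/perm_map].
rewrite !mem_avoiders perm_w; apply: andb_id2l => w_double.
apply: avoids_succ_cat_ones.
rewrite (perm_all _ w_double); apply/allP=> x.
by rewrite mem_cat mem_iota /=; lia.
Qed.

(** The two families are disjoint because a word of the second one starts with
    a letter larger than 1. *)
Lemma perm_avoidersS n :
  1 < n ->
  perm_eq (avoiders n.+1) (ones_first n :: map ones_last (avoiders n)).
Proof.
move=> n_gt1.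
have uniq_av m : uniq (avoiders m) by rewrite filter_uniq ?permutations_uniq.
have inj_last : injective ones_last.
  move=> u v /(congr1 rev); rewrite !rev_cat => -[].
  by move=> /(can_inj revK)/(inj_map succn_inj).
apply: uniq_perm => // [|w].
- rewrite /= map_inj_uniq // uniq_av andbT; apply/mapP => -[u].
  rewrite mem_avoiders => /andP[perm_u _].
  (* A common head letter of the two words is 1, hence comes from a letter 0
     in u, which is not in the alphabet. *)
  case: u perm_u => [|x u] perm_u.
    by have := perm_size perm_u; rewrite size_cat size_iota /=; lia.
  case=> x0 _; have := perm_mem perm_u 0.
  by rewrite -x0 inE eqxx mem_cat mem_iota.
- rewrite inE; apply/idP/orP => [|[/eqP->|/mapP[u av_u ->]]]; last first.
  + by rewrite ones_last_avoider.
  + exact: ones_first_avoider.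
  move=> av_w; have := av_w; rewrite mem_avoiders => /andP[perm_w av].
  case: w => [|a w] in av_w perm_w av *; first by have := perm_size perm_w.
  case: (eqVneq a 1) => [a1|a_neq1].
  + left; rewrite a1 in perm_w av *.
    by rewrite (avoider_head1 n_gt1 perm_w av).
  + right; have [p p_gt1 def_w] := avoider_headN1 n_gt1 a_neq1 perm_w av.
    have def_p : map succn (map predn p) = p.
      rewrite -map_comp map_id_in // => x /(allP p_gt1) /=; exact: ltn_predK.
    rewrite -def_p -/(ones_last _) in def_w.
    by rewrite def_w map_f // -ones_last_avoider -def_w.
Qed.

(** * The count *)

Theorem theorem2p12 (n : nat) (hn : 2 <= n) :
  c n [:: [:: 1; 2; 3]; [:: 2; 1; 3]; [:: 3; 1; 2]] = n + 2.
Proof.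
rewrite c_avoiders; elim: n hn => [|[|[|n]] IHn] // _.
  exact: size_avoiders2.
by rewrite (perm_size (perm_avoidersS _)) //= size_map IHn.
Qed.
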